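(* It holds that $2\sqrt{2}\leq\sup\{\langle\alpha,\alpha\rangle \mid \alpha\in\overline{\mathbb{Z}}\text{ is indecomposable}\}$.
   Context: $\overline{\mathbb{Q}}$ is an algebraic closure of $\mathbb{Q}$ and $\overline{\mathbb{Z}}\subseteq\overline{\mathbb{Q}}$ is the ring of algebraic integers. $\overline{\mathbb{Q}}$ carries the inner product $$\langle\alpha,\beta\rangle=\frac{1}{[\mathbb{Q}(\alpha,\beta):\mathbb{Q}]}\sum_{\sigma:\mathbb{Q}(\alpha,\beta)\to\mathbb{C}}\sigma(\alpha)\cdot\overline{\sigma(\beta)},$$ where the sum ranges over all field embeddings of $\mathbb{Q}(\alpha,\beta)$ in $\mathbb{C}$. A decomposition of $\alpha\in\overline{\mathbb{Z}}$ is a pair $(\beta,\gamma)\in\overline{\mathbb{Z}}^2$ with $\alpha=\beta+\gamma$ and $\langle\beta,\gamma\rangle\geq0$. An element $\alpha\in\overline{\mathbb{Z}}$ is indecomposable if $\alpha\neq 0$ and its only decompositions are $(\alpha,0)$ and $(0,\alpha)$. *)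

(* Defs.v *)
From mathcomp Require Import all_boot all_order all_algebra all_field.
From mathcomp Require Import complex.
From mathcomp Require Import all_classical all_reals all_analysis.

Set Implicit Arguments.
Unset Strict Implicit.
Unset Printing Implicit Defensive.

Import Order.TTheory GRing.Theory Num.Theory.

Local Open Scope classical_set_scope.
Local Open Scope ring_scope.
Local Open Scope complex_scope.

(* [algC] plays the role of the algebraic closure of the rationals and
   [R[i]] that of the complex numbers. *)

(* [num_field_exists] provides a number field K, a morphism from K to [algC],
   and elements of K mapped to a and b that generate K over the rationals:
   K is thus the subfield of [algC] generated by a and b, as an abstract
   finite extension of [rat]. *)
Definition adjoin2 (a b : algC) : fieldExtType rat :=
  projT1 (num_field_exists [:: a; b]).

Definition adjoin2_val (a b : algC) : {rmorphism adjoin2 a b -> algC} :=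
  projT1 (projT2 (num_field_exists [:: a; b])).

Definition adjoin2_gens (a b : algC) : seq (adjoin2 a b) :=
  s2val (projT2 (projT2 (num_field_exists [:: a; b]))).

Definition adjoin2_fst (a b : algC) : adjoin2 a b := (adjoin2_gens a b)`_0.

Definition adjoin2_snd (a b : algC) : adjoin2 a b := (adjoin2_gens a b)`_1.

Lemma adjoin2_fstE (a b : algC) : adjoin2_val a b (adjoin2_fst a b) = a.
Proof.
rewrite /adjoin2_fst /adjoin2_gens /adjoin2_val /adjoin2.
by case: (num_field_exists _) => K [f [[|x [|y []]]]] //= [].
Qed.

Lemma adjoin2_sndE (a b : algC) : adjoin2_val a b (adjoin2_snd a b) = b.
Proof.
rewrite /adjoin2_snd /adjoin2_gens /adjoin2_val /adjoin2.
by case: (num_field_exists _) => K [f [[|x [|y []]]]] //= [].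
Qed.

Lemma adjoin2_gen (a b : algC) :
  <<1 & [:: adjoin2_fst a b; adjoin2_snd a b]>>%VS = fullv.
Proof.
rewrite /adjoin2_fst /adjoin2_snd /adjoin2_gens /adjoin2.
by case: (num_field_exists _) => K [f [[|x [|y []]]]] //= [].
Qed.

Definition embeddings (R : realType) (K : fieldExtType rat) : set (K -> R[i]) :=
  [set (sigma : K -> R[i]) | sigma in [set: {rmorphism K -> R[i]}]].
Arguments embeddings R K : clear implicits.

(* The value is a complex number, real because the set of embeddings is stable
   under complex conjugation. *)
Definition inner (R : realType) (a b : algC) : R[i] :=
  (\dim {: adjoin2 a b})%:R^-1 *
  \sum_(sigma \in embeddings R (adjoin2 a b))
     sigma (adjoin2_fst a b) * (sigma (adjoin2_snd a b))^*.

(* In [R[i]], [0 <= z] means that z is real and nonnegative. *)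
Definition decomposition (R : realType) (a : algC) (p : algC * algC) : Prop :=
  [/\ p.1 \in Aint, p.2 \in Aint, a = p.1 + p.2 & 0 <= inner R p.1 p.2].

Definition indecomposable (R : realType) (a : algC) : Prop :=
  [/\ a \in Aint, a != 0 &
      forall p, decomposition R a p -> p = (a, 0) \/ p = (0, a)].

(* Main.v *)
From HB Require Import structures.
Require Import Defs.
From mathcomp Require Import all_boot all_order all_algebra all_field.
From mathcomp Require Import complex.
From mathcomp Require Import all_classical all_reals all_analysis.
From mathcomp Require Import ring lra zify.
Import Order.TTheory GRing.Theory Num.Theory.
Local Open Scope classical_set_scope.
Local Open Scope ring_scope.

(** The bound is approached by explicit indecomposable integers. The number
    8^(1/4) has squared norm 2 sqrt 2 but is decomposable, because of roots of
    unity close to 1 at the prime 2; the cure is to distribute its valuation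
    unequally over the two primes above 2 of the field of sqrt (-7).

    Let w be a root of X^2 - X + 2, so that w (1 - w) = 2 and w, 1 - w are
    complex conjugate and coprime, and let r ^ (2m+1) = w. The candidate is
    alpha = (1 - w) r^m, with cofactor tau = r^(m+1): tau alpha = 2. Every
    embedding gives tau the same squared absolute value
    c = 2 ^ ((m+1) / (2m+1)), slightly above sqrt 2
    ([sqr_norm_embedding]); hence <alpha, alpha> = 4 / c, which tends to
    2 sqrt 2 as m grows. On the other hand tau^2 = r w does not divide
    2 = w (1 - w), since r is not a unit and divides w, which is coprime to
    1 - w ([sqr_ndvd2]).

    Why alpha is indecomposable ([no_orthogonal_split]): suppose
    alpha = b + g with <b, g> >= 0 and put eps = (b - g) / alpha =
    1 - tau g, an algebraic integer. The hypothesis says that the mean of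
    |sigma eps|^2 is at most 1. As the norm of eps is a nonzero integer, the
    inequality between the arithmetic and geometric means is an equality here:
    |sigma eps| = 1 for every sigma. Now eps is close to 1 at the prime 2:
    eps^2 - 1 = - tau^2 b g, and each further squaring gains one more factor
    tau, because y^2 + 1 = (y^2 - 1) + tau alpha. Thus
    eps^8 - 1 = tau^4 x with x integral, and
    |sigma x| <= 2 / c^2 < 1 for every sigma, so that x = 0. The factors of x
    are b, g and two numbers whose vanishing would make tau^2 a divisor
    of 2; so b = 0 or g = 0.

    Two facts on a number field K support this: its [\dim K] embeddings can be
    listed ([embeddings_enum]), and the product of the conjugates of a nonzero
    integer has absolute value at least 1 ([norm_prod_embeddings_ge1]). *)

(** * Embeddings of a number field *)

(** A primitive element theta exists and its minimal polynomial is separable,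
    so embeddings correspond to the distinct complex roots of that polynomial.
    The element theta is part of the conclusion because it is what makes the
    Vandermonde matrix of the list [s] invertible below. *)
Lemma embeddings_enum (C : numClosedFieldType) (K : fieldExtType rat) :
  exists (s : 'I_(\dim {:K}) -> {rmorphism K -> C}) (theta : K),
    injective (fun i => s i theta) /\
    (forall sigma : {rmorphism K -> C}, exists i, sigma =1 s i).
Proof.
pose th := separable_generator 1 {:K}.
have Kth : <<1; th>>%VS = fullv.
  rewrite -(@eq_adjoin_separable_generator _ _ {:K}%AS 1%AS) ?sub1v //.
  apply/separableP => y _; apply: pcharf0_separable => p.
  by rewrite pchar_lalg; apply: pchar_num.
have [P DP] := polyOver1P (minPolyOver 1%VS th).
have szP : size P = (\dim {:K}).+1.
  rewrite -(size_map_poly (in_alg K)) -DP size_minPoly adjoin_degreeE Kth.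
  by rewrite dimv1 divn1.
have sepP : separable_poly P.
  rewrite -(separable_map (in_alg K)) -DP; apply: pcharf0_separable => p.
  by rewrite pchar_lalg; apply: pchar_num.
pose rC := map_poly (ratr : rat -> C).
have [rs Drs] := closed_field_poly_normal (rC P).
have lc0 : lead_coef (rC P) != 0.
  by rewrite lead_coef_eq0 map_poly_eq0 -size_poly_gt0 szP.
have Urs : uniq rs.
  move: sepP; rewrite -(separable_map (ratr : rat -> C)) -/(rC P) Drs.
  by rewrite (eqp_separable (eqp_scale _ lc0)) separable_prod_XsubC.
have szrs : size rs = \dim {:K}.
  have := congr1 (fun p : {poly C} => size p) Drs.
  by rewrite /= size_scale // size_prod_XsubC size_map_poly szP => -[].
have rootP r : root (rC P) r = (r \in rs).
  by rewrite Drs rootZ // root_prod_XsubC.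
(* [ev q] is q(theta), and [rC q] is q over C: an embedding sends the
   former to the value of the latter at a root. *)
pose ev (q : {poly rat}) := (map_poly (in_alg K) q).[th].
have evP x : exists q, x == ev q.
  have /Fadjoin1_polyP[q ->] : x \in <<1; th>>%VS by rewrite Kth memvf.
  by exists q.
pose g x := xchoose (evP x).
have gP x : ev (g x) = x by rewrite -(eqP (xchooseP (evP x))).
have rCB q q' : rC (q - q') = rC q - rC q' by rewrite /rC rmorphB.
have rCM q q' : rC (q * q') = rC q * rC q' by rewrite /rC rmorphM.
have rC1 : rC 1 = 1 by rewrite /rC rmorph1.
have ev_inj r q q' : r \in rs -> ev q = ev q' -> (rC q).[r] = (rC q').[r].
  move=> rrs eq_qq'; apply/eqP; rewrite -subr_eq0 -hornerN -hornerD -rCB.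
  have : minPoly 1 th %| map_poly (in_alg K) (q - q').
    rewrite minPoly_dvdp ?alg_polyOver // /root rmorphB /= hornerD hornerN subr_eq0.
    exact/eqP.
  rewrite DP dvdp_map -(dvdp_map (ratr : rat -> C)) -!/(rC _).
  by move=> /dvdpP[u ->]; rewrite hornerM (eqP (_ : root (rC P) r)) ?mulr0 ?rootP.
have evB q q' : ev (q - q') = ev q - ev q' by rewrite /ev rmorphB hornerD hornerN.
have evM q q' : ev (q * q') = ev q * ev q' by rewrite /ev rmorphM hornerM.
have ev1 : ev 1 = 1 by rewrite /ev rmorph1 hornerC.
have sigmaP r : r \in rs -> exists f : {rmorphism K -> C}, f th = r.
  move=> rrs; pose f x := (rC (g x)).[r].
  have fB : zmod_morphism f.
    by move=> x y; rewrite /f -hornerN -hornerD -rCB; apply: ev_inj; rewrite // evB !gP.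
  have fM : monoid_morphism f.
    split=> [|x y].
      have <- : (rC 1).[r] = 1 by rewrite rC1 hornerC.
      by apply: ev_inj; rewrite // gP ev1.
    by rewrite /f -hornerM -rCM; apply: ev_inj; rewrite // evM !gP.
  pose fz := GRing.isZmodMorphism.Build _ _ f fB.
  pose fm := GRing.isMonoidMorphism.Build _ _ f fM.
  pose F : {rmorphism K -> C} := HB.pack f fz fm.
  exists F; have <- : (rC 'X).[r] = r by rewrite /rC map_polyX hornerX.
  by apply: ev_inj; rewrite // gP /ev map_polyX hornerX.
have rsP (i : 'I_(\dim {:K})) : exists f : {rmorphism K -> C}, f th = rs`_i.
  by apply/sigmaP/mem_nth; rewrite szrs.
have [s sP] := fin_all_exists rsP.
exists s, th; split=> [i j|sigma].
  by rewrite !sP => /eqP; rewrite nth_uniq ?szrs // => /eqP/val_inj.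
have sev (f : {rmorphism K -> C}) q : f (ev q) = (rC q).[f th].
  rewrite -horner_map -map_poly_comp; congr (_.[_]).
  by apply: eq_map_poly => a; exact: fmorph_eq_rat.
have th_rs : sigma th \in rs.
  rewrite -rootP /root -sev /ev -DP minPolyxx rmorph0 //.
have lt_i : (index (sigma th) rs < \dim {:K})%N by rewrite -szrs index_mem.
exists (Ordinal lt_i) => x; rewrite -(gP x) !sev sP nth_index //.
Qed.

(** Multiplication by x is a rational matrix in a basis of K, and the matrix of
    the conjugates of that basis diagonalizes it, with eigenvalues the
    conjugates of x. That matrix is invertible because it divides the
    Vandermonde matrix of the conjugates of theta. *)
Lemma prod_embeddings_rat (C : numClosedFieldType) (K : fieldExtType rat)
    (s : 'I_(\dim {:K}) -> {rmorphism K -> C}) (theta : K) (x : K) :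
  injective (fun i => s i theta) -> exists q : rat, \prod_i s i x = ratr q.
Proof.
move=> inj_s; set d := \dim {:K} in s inj_s *; pose e := vbasis {:K}.
pose values (y : 'I_d -> K) : 'M[C]_d := \matrix_(j, i) s i (y j).
pose E := values (fun j => e`_j).
pose coords (y : 'I_d -> K) : 'M[rat]_d := \matrix_(j, k) coord e k (y j).
have valuesE y : values y = map_mx ratr (coords y) *m E.
  apply/matrixP => j i; rewrite !mxE.
  rewrite {1}(coord_vbasis (memvf (y j))) rmorph_sum; apply: eq_bigr => k _.
  by rewrite !mxE rmorphZ_num.
have detE : \det E != 0.
  have : \det (Vandermonde d (\row_i s i theta)) != 0.
    rewrite det_Vandermonde; apply/prodf_neq0 => i _; apply/prodf_neq0 => j ij.
    by rewrite !mxE subr_eq0 (inj_eq inj_s) -val_eqE gtn_eqF.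
  have -> : Vandermonde d (\row_i s i theta) = values (fun j => theta ^+ j).
    by apply/matrixP => j i; rewrite !mxE rmorphXn.
  by rewrite valuesE det_mulmx mulf_eq0 negb_or => /andP[].
exists (\det (coords (fun j => e`_j * x))).
rewrite -det_map_mx; apply: (mulIf detE); rewrite -det_mulmx -valuesE.
rewrite mulrC; have <- : \det (diag_mx (\row_i s i x)) = \prod_i s i x.
  by rewrite det_diag; apply: eq_bigr => i _; rewrite mxE.
rewrite -det_mulmx; congr (\det _); apply/matrixP => j i.
by rewrite mul_mx_diag !mxE rmorphM.
Qed.

(** * Integrality and the norm *)

Lemma map_poly_intr (R S : nzRingType) (g : {rmorphism R -> S}) (p : {poly int}) :
  map_poly g (map_poly intr p) = map_poly intr p.
Proof. by rewrite -map_poly_comp; apply: eq_map_poly => a /=; rewrite rmorph_int. Qed.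

Lemma monic_map_intr (R : numDomainType) (p : {poly int}) :
  (map_poly (intr : int -> R) p \is monic) = (p \is monic).
Proof. by rewrite !monicE lead_coef_map_inj ?(eqr_int _ _ 1) //; exact: intr_inj. Qed.

Lemma Aint_root_int z : z \in Aint ->
  exists2 p : {poly int}, p \is monic & root (map_poly intr p) z.
Proof.
move=> zA; have /floorpP[p Dp] : minCpoly z \is a polyOver Num.int by [].
exists p; last by rewrite -Dp root_minCpoly.
by have := minCpoly_monic z; rewrite Dp monic_map_intr.
Qed.

(** Integrality passes from [algC] to the target field of an arbitrary
    embedding, since it is witnessed by a polynomial over the integers. *)
Lemma integral_embedding (C : numClosedFieldType) (K : fieldExtType rat)
    (f : {rmorphism K -> algC}) (sigma : {rmorphism K -> C}) (x : K) :
  f x \in Aint -> integralOver (intr : int -> C) (sigma x).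
Proof.
case/Aint_root_int => p pm; rewrite -(map_poly_intr _ _ f) fmorph_root => px.
by exists p => //; rewrite -(map_poly_intr _ _ sigma) fmorph_root.
Qed.

Lemma integral_rat_norm_ge1 (C : numClosedFieldType) (q : rat) :
  integralOver (intr : int -> C) (ratr q) -> q != 0 -> 1 <= `|ratr q : C|.
Proof.
case=> p pm; rewrite -(map_poly_intr _ _ (ratr : rat -> C)) fmorph_root.
rewrite -(fmorph_root (ratr : rat -> algC)) map_poly_intr => pq q0.
have /Cint_rat_Aint : (ratr q : algC) \in Crat by apply: Crat_rat.
have -> : (ratr q : algC) \in Aint.
  apply: (root_monic_Aint pq); first by rewrite monic_map_intr.
  by apply/polyOverP => i; rewrite coef_map intr_int.
move=> /(_ isT) /intrP[a qa].
have {qa} qa : q = a%:~R by apply: (fmorph_inj (ratr : rat -> algC)); rewrite /= qa ratr_int.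
rewrite qa ratr_int -intr_norm; move: q0; rewrite qa intr_eq0 => a0.
by rewrite (ler1z _ `|a|) -gtz0_ge1 normr_gt0.
Qed.

Lemma norm_prod_embeddings_ge1 (C : numClosedFieldType) (K : fieldExtType rat)
    (s : 'I_(\dim {:K}) -> {rmorphism K -> C}) (theta : K)
    (f : {rmorphism K -> algC}) (x : K) :
    injective (fun i => s i theta) -> f x \in Aint -> x != 0 ->
  1 <= \prod_i `|s i x|.
Proof.
move=> inj_s xA x0; rewrite -normr_prod.
have [q Dq] := prod_embeddings_rat C K s theta x inj_s; rewrite Dq.
apply: integral_rat_norm_ge1.
  rewrite -Dq; elim/big_ind: _ => [|u v|i _]; first exact: integral1.
    exact: integral_mul.
  exact: integral_embedding xA.
rewrite -(fmorph_eq0 (ratr : rat -> C)) /= -Dq; apply/prodf_neq0 => i _.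
by rewrite fmorph_eq0.
Qed.

Lemma Aint_expr n x : (0 < n)%N -> x ^+ n \in Aint -> x \in Aint.
Proof.
move=> n0 xA; apply: (@root_monic_Aint (minCpoly (x ^+ n) \Po 'X^n)).
- by rewrite /root horner_comp hornerXn; exact: root_minCpoly.
- rewrite monicE lead_coef_comp ?size_polyXn // lead_coefXn expr1n mulr1.
  exact: minCpoly_monic.
- by apply: polyOver_comp => //; rewrite rpredX ?polyOverX.
Qed.

(** * The two primes above 2 in the field of sqrt (-7) *)

(** The discriminant -7 is negative, so w is not real and its conjugate is the
    other root. *)
Lemma conj_root_sqrtN7 (C : numClosedFieldType) (w : C) :
  w ^+ 2 = w - 2 -> w^* = 1 - w.
Proof.
move=> w2; have w2' : (w^*) ^+ 2 = w^* - 2.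
  by rewrite -rmorphXn w2 rmorphB /= conjC_nat.
have /eqP : (w^* - w) * (w^* - (1 - w)) = 0.
  by transitivity ((w^*) ^+ 2 - w^* - (w ^+ 2 - w)); [ring | rewrite w2 w2'; ring].
rewrite mulf_eq0 !subr_eq0 => /orP[/eqP/CrealP wR|/eqP//].
have : 0 <= (2 * w - 1) ^+ 2.
  rewrite real_exprn_even_ge0 // rpredB ?rpred1 //.
  by rewrite rpredM ?rpred_nat.
have -> : (2 * w - 1) ^+ 2 = - 7 by transitivity (4 * w ^+ 2 - 4 * w + 1); [ring | rewrite w2; ring].
by rewrite oppr_ge0 lern0.
Qed.

Lemma norm_root_sqrtN7 (C : numClosedFieldType) (w : C) :
  w ^+ 2 = w - 2 -> `|w| ^+ 2 = 2.
Proof.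
move=> w2; rewrite normCK (conj_root_sqrtN7 _ _ w2).
by transitivity (w - w ^+ 2); [ring | rewrite w2; ring].
Qed.

(** Modulo 2 the ring generated by w is a product of two fields with two elements
    and w is idempotent, whence the parities of the two coordinates. *)
Lemma expr_root_sqrtN7 (A : comNzRingType) (m : nat) :
  exists u v : int, forall w : A, w ^+ 2 = w - 2 ->
    w ^+ m.+1 = (2 * u)%:~R + (2 * v + 1)%:~R * w.
Proof.
elim: m => [|m [u [v IH]]].
  by exists 0, 0 => w _; rewrite expr1 mulr0 add0r mul1r.
exists (- (2 * v + 1)), (u + v) => w w2.
rewrite exprSr IH // mulrDl -mulrA -expr2 w2.
rewrite !(rmorphM, rmorphD, rmorphN, rmorph1) /=. ring.
Qed.

(** A field that contains a positive power of w contains w, because the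
    coordinate of that power along w is odd, hence not zero. *)
Lemma root_sqrtN7_descent (K : fieldType) (L : numFieldType) (f : {rmorphism K -> L}) m (y : K) (w : L) :
  w ^+ 2 = w - 2 -> f y = w ^+ m.+1 ->
  exists2 k : K, k ^+ 2 = k - 2 & y = k ^+ m.+1.
Proof.
move=> w2 fy; have [u [v uv]] := expr_root_sqrtN7 L m.
have v0 : (2 * v + 1)%:~R != 0 :> L by rewrite intr_eq0; lia.
pose k := (y - (2 * u)%:~R) / (2 * v + 1)%:~R.
have fk : f k = w.
  by rewrite /k fmorph_div rmorphB fy uv // !rmorph_int addrC addKr mulrC mulKf.
exists k; apply: (fmorph_inj f).
  by rewrite rmorphXn rmorphB /= fk w2 rmorph_nat.
by rewrite rmorphXn /= fk.
Qed.

Lemma Aint_root_sqrtN7 w : w ^+ 2 = w - 2 -> w \in Aint.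
Proof.
move=> w2; apply: (@root_monic_Aint ('X^2 - ('X - 2%:P))).
- by rewrite /root !hornerE w2 subrr.
- rewrite monicE lead_coefDl ?lead_coefXn //.
  by rewrite size_polyN size_XsubC size_polyXn.
- apply/polyOverP => i; rewrite !coefB coefXn coefX coefC.
  by rewrite !rpredB ?rpred_nat //; case: ifP; rewrite ?rpred_nat ?rpred0.
Qed.

(** The number r^(2m+2) is r w, so if it divided 2 = w (1 - w) then r would
    divide 1 - w. Raising to the power 2m+1, w would divide (1 - w)^(2m+1),
    to which it is coprime; so w, and likewise its conjugate 1 - w, would be a
    unit, against w (1 - w) = 2. *)
Lemma sqr_ndvd2 m (w r z : algC) : w ^+ 2 = w - 2 ->
  r ^+ m.*2.+1 = w -> z \in Aint -> (r ^+ m.+1) ^+ 2 * z != 2.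
Proof.
move=> w2 rw zA; apply/eqP => rz2.
have wA : w \in Aint by exact: Aint_root_sqrtN7.
have w0 : w != 0.
  apply: contra_eq_neq w2 => ->; rewrite expr0n /= sub0r eq_sym oppr_eq0.
  by rewrite pnatr_eq0.
have Dw : 1 - w = r * z.
  apply: (mulIf w0); transitivity (w - w ^+ 2); first by ring.
  rewrite w2; transitivity (2 : algC); first by ring.
  by rewrite -rz2 -exprM mulnC mul2n doubleS exprS rw; ring.
pose n := m.*2.+1.
have unit_w : w^-1 \in Aint.
  suff -> : w^-1 = z ^+ n + \sum_(i < n) (1 - w) ^+ i.
    by rewrite rpredD ?rpredX ?rpred_sum // => i _; rewrite rpredX ?rpredB.
  apply: (mulfI w0); rewrite divff // mulrDr -[w in w * z ^+ n]rw -exprMn -Dw.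
  apply/eqP; rewrite -subr_eq0; apply/eqP.
  transitivity (- ((1 - w) ^+ n - 1 - ((1 - w) - 1) * \sum_(i < n) (1 - w) ^+ i)).
    by ring.
  by rewrite subrX1 subrr oppr0.
have unit_w' : (1 - w)^-1 \in Aint.
  by rewrite -(conj_root_sqrtN7 _ _ w2) -fmorphV; rewrite (Aint_aut Num.conj).
have half : 2^-1 \in Aint.
  have -> : 2^-1 = w^-1 * (1 - w)^-1 :> algC.
    rewrite -invfM; congr (_^-1); transitivity (w - w ^+ 2); last by ring.
    by rewrite w2; ring.
  exact: rpredM.
have half_rat : 2^-1 \in Crat by rewrite rpredV rpred_nat.
have /intrP[a] := Cint_rat_Aint half_rat half.
move/(congr1 ( *%R 2)); rewrite divff ?pnatr_eq0 // -(intrM _ 2).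
move/eqP; rewrite (eqr_int _ 1); lia.
Qed.

(** The embedding sigma is defined on K only, which need not contain r; but K
    contains a root k of X^2 - X + 2, of which t^(2m+1) is a power. *)
Lemma sqr_norm_embedding (C : numClosedFieldType) (K : fieldExtType rat)
    (f : {rmorphism K -> algC}) (sigma : {rmorphism K -> C}) m (r w : algC) (t : K) (c : C) :
    w ^+ 2 = w - 2 -> r ^+ m.*2.+1 = w -> f t = r ^+ m.+1 ->
    0 <= c -> c ^+ m.*2.+1 = 2 ^+ m.+1 ->
  `|sigma t| ^+ 2 = c.
Proof.
move=> w2 rw ft c0 cn.
have [|k k2 tk] := root_sqrtN7_descent _ _ f m (t ^+ m.*2.+1) w w2.
  by rewrite rmorphXn /= ft -exprM mulnC exprM rw.
have sk : `|sigma k| ^+ 2 = 2.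
  by apply: norm_root_sqrtN7; rewrite -rmorphXn k2 rmorphB rmorph_nat.
apply: (@pexpIrn _ m.*2.+1) => //; first by rewrite nnegrE exprn_ge0.
rewrite cn -sk -!exprM mulnC exprM -normrX -rmorphXn tk rmorphXn normrX.
by rewrite -!exprM mulnC.
Qed.


(** * Decompositions of a divisor of 2 *)

(** Here 1 - t g = (b - g) / (b + g), and |b - g|^2 is |b + g|^2 minus four times
    the real part of b g^*. *)
Lemma normC_split (C : numClosedFieldType) (b g t c : C) :
  t * (b + g) = 2 -> `|t| ^+ 2 = c ->
  `|1 - t * g| ^+ 2 = 1 - c / 2 * (b * g^* + (b * g^*)^*).
Proof.
move=> tbg tc; have -> : 1 - t * g = t * (b - g) / 2.
  apply: (mulIf (_ : 2 != 0 :> C)); first by rewrite pnatr_eq0.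
  rewrite mulfVK ?pnatr_eq0 // mulrBl mul1r -[X in X - _]tbg; ring.
have nb : `|t * (b + g)| ^+ 2 = 4 by rewrite tbg normr_nat -natrX.
rewrite normrM normfV normr_nat normrM !exprMn tc normCK.
move: nb; rewrite normrM exprMn tc normCK !(rmorphD, rmorphN, rmorphM) /= conjCK => nb.
have -> : (b - g) * (b^* - g^*) = (b + g) * (b^* + g^*) - 2 * (b * g^* + b^* * g) by ring.
by rewrite mulrDr mulrDl mulrA nb; field.
Qed.

(** This is the equality case of the inequality between the arithmetic and the
    geometric mean. *)
Lemma norm_eq1_of_mean (F : numFieldType) d (x : 'I_d -> F) :
    (forall i, 0 <= x i) -> 1 <= \prod_i x i -> \sum_i x i <= d%:R ->
  forall i, x i = 1.
Proof.
move=> x0 px sx i.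
have d0 : (0 < d)%N by case: (d) i => // -[].
have [le_AGM eq_AGM] := @leif_AGM F 'I_d predT x (fun j _ => x0 j).
rewrite cardT size_enum_ord in le_AGM eq_AGM.
have mu0 : 0 <= (\sum_i x i) / d%:R by rewrite divr_ge0 ?sumr_ge0 ?ler0n.
have mu1 : ((\sum_i x i) / d%:R) ^+ d <= 1.
  by rewrite exprn_ile1 // ler_pdivrMr ?ltr0n // mul1r.
have prod1 : \prod_i x i = 1 by apply/le_anti; rewrite px (le_trans le_AGM).
move: eq_AGM; rewrite prod1 eq_le mu1 -{1}prod1 le_AGM => /esym/forallP/(_ i)/forallP xE.
have {}xE j : x j = x i by apply/esym/eqP; apply: (implyP (xE j)).
apply/eqP; rewrite -(pexpr_eq1 d0) // -[X in _ == X]prod1.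
rewrite (eq_bigr (fun=> x i)) ?prodr_const ?card_ord // => j _; exact: xE.
Qed.

(** The strict inequality [2 < c ^+ 2] is what makes t^4, of absolute value c^2
    at every embedding, larger than eps^8 - 1, of absolute value at most 2,
    where eps = 1 - t g. That t^2 does not divide 2 excludes the factors of
    the quotient other than b and g. *)
Lemma no_orthogonal_split (C : numClosedFieldType) (K : fieldExtType rat)
    (s : 'I_(\dim {:K}) -> {rmorphism K -> C}) (theta : K)
    (f : {rmorphism K -> algC}) (b g t : K) (c : C) :
    injective (fun i => s i theta) ->
    f b \in Aint -> f g \in Aint -> f t \in Aint ->
    t * (b + g) = 2 -> (forall z, z \in Aint -> f t ^+ 2 * z != 2) ->
    (forall i, `|s i t| ^+ 2 = c) -> 2 < c ^+ 2 ->
    0 <= \sum_i s i b * (s i g)^* ->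
  b = 0 \/ g = 0.
Proof.
move=> inj_s bA gA tA tbg ndvd tc c2 S0.
pose a := b + g; pose eps := 1 - t * g.
have aA : f a \in Aint by rewrite rmorphD rpredD.
have not2 z : f z \in Aint -> t ^+ 2 * z = 2 -> False.
  move=> zA /(congr1 f); rewrite rmorphM rmorphXn rmorph_nat => tz.
  by have := ndvd _ zA; rewrite tz eqxx.
have d0 : (0 < \dim {:K})%N by rewrite adim_gt0.
have c0 : 0 <= c by rewrite -(tc (Ordinal d0)) exprn_ge0.
have eps0 : eps != 0.
  apply/negP => /eqP e0; apply: (not2 (g * g * 2)).
    by rewrite !rmorphM rmorph_nat !rpredM ?rpred_nat.
  have tg : t * g = 1 by apply/esym/eqP; rewrite -subr_eq0 -/eps e0.
  by transitivity ((t * g) * (t * g) * 2); [ring | rewrite tg !mul1r].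
have epsA : f eps \in Aint by rewrite rmorphB rmorph1 rmorphM rpredB ?rpredM ?rpred1.
have eps1 i : `|s i eps| = 1.
  apply/eqP; rewrite -sqrp_eq1 ?normr_ge0 //; apply/eqP.
  apply: (@norm_eq1_of_mean _ _ (fun i => `|s i eps| ^+ 2)) => [j||].
  - by rewrite exprn_ge0.
  - rewrite prodrXl exprn_ege1 //.
    exact: (norm_prod_embeddings_ge1 _ _ _ theta f).
  rewrite (eq_bigr (fun i => 1 - c / 2 * (s i b * (s i g)^* + (s i b * (s i g)^* )^*))); last first.
    move=> j _; rewrite rmorphB rmorph1 rmorphM; apply: normC_split => //.
    by rewrite -rmorphD -rmorphM tbg rmorph_nat.
  rewrite sumrB -mulr_sumr big_split /= -rmorph_sum sumr_const card_ord.
  rewrite lerBlDr lerDl mulr_ge0 ?divr_ge0 ?ler0n // addr_ge0 //.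
  by rewrite conjC_ge0.
(* The cofactor of [t ^+ 4] in [eps ^+ 8 - 1], read off from the
   factorization into [eps ^+ 2 - 1], [eps ^+ 2 + 1] and [eps ^+ 4 + 1]. *)
pose x := - b * g * (a - t * b * g) * (a - t ^+ 2 * b * g * (a - t * b * g)).
have eps8 : eps ^+ 8 - 1 = t ^+ 4 * x.
  have e2 : eps ^+ 2 - 1 = - (t ^+ 2 * b * g).
    by transitivity (t ^+ 2 * g ^+ 2 - t * g * 2); [rewrite /eps; ring | rewrite -tbg; ring].
  have e2' : eps ^+ 2 + 1 = t * (a - t * b * g).
    by transitivity (eps ^+ 2 - 1 + 2); [ring | rewrite e2 -tbg /a; ring].
  have e4 : eps ^+ 4 - 1 = - (t ^+ 3 * b * g * (a - t * b * g)).
    by transitivity ((eps ^+ 2 - 1) * (eps ^+ 2 + 1)); [ring | rewrite e2 e2'; ring].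
  have e4' : eps ^+ 4 + 1 = t * (a - t ^+ 2 * b * g * (a - t * b * g)).
    by transitivity (eps ^+ 4 - 1 + 2); [ring | rewrite e4 -tbg /a; ring].
  by transitivity ((eps ^+ 4 - 1) * (eps ^+ 4 + 1)); [ring | rewrite e4 e4' /x; ring].
have xA : f x \in Aint.
  rewrite /x !(rmorphM, rmorphN, rmorphB, rmorphXn) /=.
  by rewrite !(rpredM, rpredN, rpredB, rpredX).
(* All conjugates of x have absolute value below 1, so its norm is 0. *)
have x0 : x = 0.
  apply/eqP; apply: contraT => x0.
  have := norm_prod_embeddings_ge1 _ _ s theta f x inj_s xA x0.
  rewrite real_leNgt ?rpred1 ?rpred_prod //; last by move=> i _; exact: normr_real.
  move=> /negP[]; have one : \prod_(i < \dim {:K}) 1 = 1 :> C by rewrite big1.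
  rewrite -[X in _ < X]one.
  apply: ltr_prod; first by apply/hasP; exists (Ordinal d0); rewrite // mem_index_enum.
  move=> i _; rewrite normr_ge0 /=.
  have : c ^+ 2 * `|s i x| <= 2.
    rewrite -(tc i) -exprM -normrX -normrM -rmorphXn -rmorphM -eps8.
    rewrite rmorphB rmorphXn rmorph1 (le_trans (ler_normB _ _)) //.
    by rewrite normrX eps1 expr1n normr1.
  have c20 : 0 < c ^+ 2 by apply: lt_trans c2; rewrite ltr0n.
  move=> h; rewrite -(ltr_pM2l c20) mulr1.
  exact: le_lt_trans h c2.
move: x0 => /eqP; rewrite /x !mulf_eq0 oppr_eq0 -!orbA => /or4P[/eqP->|/eqP->||]; [by left|by right| |].
- rewrite subr_eq0 => /eqP aE.
  exfalso; apply: (not2 (b * g)); first by rewrite rmorphM rpredM.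
  by rewrite -tbg -/a aE; ring.
- rewrite subr_eq0 => /eqP aE.
  exfalso; apply: (not2 (t * b * g * (a - t * b * g))).
    by rewrite !(rmorphM, rmorphB) /= !(rpredM, rpredB).
  by rewrite -tbg -/a [X in _ = t * X]aE; ring.
Qed.

(** * The inner product as a finite sum *)

Lemma inner_sumE (R : realType) (a b : algC)
    (s : 'I_(\dim {: adjoin2 a b}) -> {rmorphism adjoin2 a b -> R[i]}%C)
    (theta : adjoin2 a b) :
    injective (fun i => s i theta) ->
    (forall sigma : {rmorphism adjoin2 a b -> R[i]}%C, exists i, sigma =1 s i) ->
  inner R a b = (\dim {: adjoin2 a b})%:R^-1 *
    \sum_i s i (adjoin2_fst a b) * Num.conj (s i (adjoin2_snd a b)).
Proof.
move=> inj_s all_s; rewrite /inner; congr (_ * _).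
have bij_s : set_bij [set: 'I_(\dim {: adjoin2 a b})] (embeddings R (adjoin2 a b))
    (fun i => s i : _ -> _).
  split=> [i _ | i j _ _ eq_s | _ [sigma _ <-]].
  - by exists (s i).
  - by apply: inj_s; exact: (congr1 (fun g => g theta) eq_s).
  - by have [i sE] := all_s sigma; exists i => //; apply/funext => x; rewrite sE.
rewrite (reindex_fsbig _ _ _ _ bij_s) -[RHS]big_enum /= [RHS]fsbig_seq ?enum_uniq //.
apply: eq_fsbigl; apply/seteqP; split=> i //= _; exact: mem_enum.
Qed.

Lemma mean_const (F : numFieldType) d (x : 'I_d -> F) (a : F) :
  (0 < d)%N -> (forall i, x i = a) -> d%:R^-1 * \sum_i x i = a.
Proof.
move=> d0 xa; rewrite (eq_bigr _ (fun i _ => xa i)) sumr_const card_ord.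
by rewrite -[a *+ d]mulr_natl mulKf // pnatr_eq0 -lt0n.
Qed.

(** * The indecomposable numbers *)

(** With w (1 - w) = 2 and r ^ (2m+1) = w, this is 2 / r^(m+1), written in a form
    that shows its integrality. *)
Definition unbalanced_divisor (w r : algC) (m : nat) : algC := (1 - w) * r ^+ m.

Lemma mul_unbalanced_divisor m (w r : algC) :
    w ^+ 2 = w - 2 -> r ^+ m.*2.+1 = w ->
  r ^+ m.+1 * unbalanced_divisor w r m = 2.
Proof.
move=> w2 rw; rewrite /unbalanced_divisor mulrCA -exprD addSn addnn rw.
by transitivity (w - w ^+ 2); [ring | rewrite w2; ring].
Qed.

Lemma unbalanced_divisor_neq0 m (w r : algC) :
  w ^+ 2 = w - 2 -> r ^+ m.*2.+1 = w -> unbalanced_divisor w r m != 0.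
Proof.
move=> w2 rw; apply/eqP => a0; have /eqP := mul_unbalanced_divisor m w r w2 rw.
by rewrite a0 mulr0 eq_sym pnatr_eq0.
Qed.

Lemma cofactor_lift (K : fieldExtType rat) (f : {rmorphism K -> algC}) (a : K)
    m (w r : algC) :
    w ^+ 2 = w - 2 -> r ^+ m.*2.+1 = w -> f a = unbalanced_divisor w r m ->
  exists2 t, t * a = 2 & f t = r ^+ m.+1.
Proof.
move=> w2 rw fa; have alpha0 := unbalanced_divisor_neq0 m w r w2 rw.
have a0 : a != 0 by rewrite -(fmorph_eq0 f) fa.
exists (2 / a); first by rewrite divfK.
by rewrite fmorph_div fa rmorph_nat -(mul_unbalanced_divisor m w r w2 rw) mulfK.
Qed.

Lemma unbalanced_divisor_indecomposable (R : realType) m (w r : algC) (c : R) :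
    w ^+ 2 = w - 2 -> r ^+ m.*2.+1 = w ->
    0 < c -> c ^+ m.*2.+1 = 2 ^+ m.+1 -> 2 < c ^+ 2 ->
  indecomposable R (unbalanced_divisor w r m).
Proof.
move=> w2 rw c0 cn c2; have wA := Aint_root_sqrtN7 w w2.
have rA : r \in Aint by apply: (@Aint_expr m.*2.+1); rewrite // rw.
have cC : (c%:C)%C ^+ m.*2.+1 = 2 ^+ m.+1 :> R[i]%C.
  by rewrite -rmorphXn cn rmorphXn rmorph_nat.
have cC0 : 0 <= c%:C%C :> R[i]%C by rewrite lecR ltW.
split; first by rewrite /unbalanced_divisor rpredM ?rpredX ?rpredB ?rpred1.
  exact: unbalanced_divisor_neq0.
move=> -[b g] [/= bA gA abg S0].
have [s [th [inj_s all_s]]] := embeddings_enum R[i]%C (adjoin2 b g).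
move: (adjoin2_val b g) (adjoin2_fstE b g) (adjoin2_sndE b g) => f.
set b' := adjoin2_fst b g; set g' := adjoin2_snd b g => fb fg.
have [t tbg ft] : exists2 t, t * (b' + g') = 2 & f t = r ^+ m.+1.
  by apply: (cofactor_lift _ f _ m w r w2 rw); rewrite rmorphD fb fg abg.
have d0 : 0 < (\dim {: adjoin2 b g})%:R :> R[i]%C by rewrite ltr0n adim_gt0.
have [||||||||b0|g0] := @no_orthogonal_split R[i]%C _ s th f b' g' t c%:C%C inj_s.
- by rewrite fb.
- by rewrite fg.
- by rewrite ft rpredX.
- exact: tbg.
- by move=> z; rewrite ft; exact: (sqr_ndvd2 m w).
- by move=> i; apply: (sqr_norm_embedding _ _ f (s i) m r w).
- by rewrite -rmorphXn -(rmorph_nat (real_complex R)) ltcR.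
- move: S0; rewrite (inner_sumE _ _ _ s th) // => S0.
  by rewrite -(pmulr_rge0 _ (_ : 0 < (\dim {: adjoin2 b g})%:R^-1)) ?invr_gt0.
- by right; rewrite abg -fb b0 rmorph0 add0r.
- by left; rewrite abg -fg g0 rmorph0 addr0.
Qed.

Lemma inner_unbalanced_divisor (R : realType) m (w r : algC) (c : R) :
    w ^+ 2 = w - 2 -> r ^+ m.*2.+1 = w ->
    0 < c -> c ^+ m.*2.+1 = 2 ^+ m.+1 ->
  complex.Re (inner R (unbalanced_divisor w r m) (unbalanced_divisor w r m)) =
  4 / c.
Proof.
move=> w2 rw c0 cn; set alpha := unbalanced_divisor w r m.
have cC : (c%:C)%C ^+ m.*2.+1 = 2 ^+ m.+1 :> R[i]%C.
  by rewrite -rmorphXn cn rmorphXn rmorph_nat.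
have cC0 : 0 <= c%:C%C :> R[i]%C by rewrite lecR ltW.
have [s [th [inj_s all_s]]] := embeddings_enum R[i]%C (adjoin2 alpha alpha).
rewrite (inner_sumE _ _ _ s th) //.
have -> : adjoin2_snd alpha alpha = adjoin2_fst alpha alpha.
  by apply: (fmorph_inj (adjoin2_val alpha alpha)); rewrite adjoin2_fstE adjoin2_sndE.
move: (adjoin2_val alpha alpha) (adjoin2_fstE alpha alpha) => f.
set a := adjoin2_fst alpha alpha => fa.
have [t ta ft] := cofactor_lift _ f a m w r w2 rw fa.
have sa i : s i a * Num.conj (s i a) = (4 / c)%:C%C.
  have st : `|s i t| ^+ 2 = c%:C%C by apply: (sqr_norm_embedding _ _ f (s i) m r w).
  have c'0 : c%:C%C != 0 :> R[i]%C by rewrite fmorph_eq0 gt_eqF.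
  apply: (mulfI c'0); rewrite -[in LHS]st -normCK -exprMn -normrM -rmorphM ta.
  rewrite -rmorphM mulrCA divff ?gt_eqF // mulr1 !rmorph_nat normr_nat.
  by rewrite -natrX.
by rewrite (mean_const _ _ _ _ _ sa) // adim_gt0.
Qed.

(** * Approaching 2 sqrt 2 *)

Lemma bernoulli_inequality (R : numDomainType) (x : R) n : 0 <= x -> 1 + x *+ n <= (1 + x) ^+ n.
Proof.
move=> x0; elim: n => [|n IH]; first by rewrite mulr0n addr0 expr0.
rewrite exprS (le_trans _ (ler_wpM2l _ IH)) ?addr_ge0 //.
rewrite mulrDr mulr1 mulrS mulrDl mul1r addrA lerD2l.
by rewrite lerDl mulr_ge0 // mulrn_wge0.
Qed.

(** Here c = sqrt 2 * e with e^(2m+1) = sqrt 2; by the Bernoulli inequality e exceeds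
    1 by at most 1 / (2m+1). *)
Lemma near_sqrt2 (R : realType) m : exists c : R,
  [/\ 0 < c, c ^+ m.*2.+1 = 2 ^+ m.+1, 2 < c ^+ 2
    & 2 * Num.sqrt 2 * (1 - m.*2.+1%:R^-1) <= 4 / c].
Proof.
set n := m.*2.+1; pose q := Num.sqrt 2 : R.
have q2 : q ^+ 2 = 2 by rewrite sqr_sqrtr.
have q0 : 0 < q by rewrite sqrtr_gt0.
have q1 : 1 < q by rewrite -(@ltr_pXn2r _ 2%N) ?nnegrE ?ltW // q2 expr1n ltr1n.
have qlt2 : q < 2.
  by rewrite -(@ltr_pXn2r _ 2%N) ?nnegrE ?ltW // q2 -natrX ltr_nat.
pose e := q `^ n%:R^-1.
have en : e ^+ n = q by rewrite -powR_mulrn ?powR_ge0 // -powRrM mulVf ?pnatr_eq0 // powRr1 // ltW.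
have e0 : 0 < e by rewrite powR_gt0.
have e1 : 1 < e by rewrite -(@ltr_pXn2r _ n) ?nnegrE ?ltW // en expr1n.
exists (q * e); split.
- exact: mulr_gt0.
- rewrite exprMn en -exprSr /n -doubleS -mul2n exprM q2 //.
- by rewrite exprMn q2 ltr_pMr // exprn_egt1.
have eb : e * (1 - n%:R^-1) <= 1.
  have h := @bernoulli_inequality _ (e - 1) n.
  have : 1 + (e - 1) *+ n <= q by rewrite -en -[e in e ^+ n](subrKC 1) h // subr_ge0 ltW.
  have n0 : 0 < n%:R :> R by rewrite ltr0n.
  rewrite -mulr_natr => h2.
  have eu : e - 1 <= n%:R^-1 by rewrite -[leRHS]mul1r ler_pdivlMr //; lra.
  have u0 : 0 < n%:R^-1 :> R by rewrite invr_gt0.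
  have u1 : n%:R^-1 <= 1 :> R by rewrite invf_le1 // ler1n.
  nra.
rewrite ler_pdivlMr ?mulr_gt0 //.
have -> : 2 * q * (1 - n%:R^-1) * (q * e) = 2 * q ^+ 2 * (e * (1 - n%:R^-1)) by ring.
by rewrite q2; lra.
Qed.

Theorem theorem1p6 (R : realType) :
  ((2 * Num.sqrt 2 : R)%:E <=
   ereal_sup [set (complex.Re (inner R a a))%:E | a in indecomposable R])%E.
Proof.
have [s7 s7E] : exists s7 : algC, s7 ^+ 2 = - 7 by exists (sqrtC (- 7)); exact: sqrtCK.
pose w := (1 + s7) / 2.
have w2 : w ^+ 2 = w - 2.
  transitivity ((1 + 2 * s7 + s7 ^+ 2) / 4); first by rewrite /w; field.
  by rewrite s7E /w; field.
apply/lee_subgt0Pr => e e0.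
pose q : R := 2 * Num.sqrt 2.
have q0 : 0 <= q by rewrite mulr_ge0 ?sqrtr_ge0.
pose m := Num.bound (q / e); pose n := m.*2.+1.
have [c [c0 cn c2 qc]] := near_sqrt2 R m.
have rw : (n.-root w) ^+ n = w by rewrite rootCK.
apply: (@le_trans _ _ (4 / c)%:E).
  rewrite -EFinB lee_fin (le_trans _ qc) // mulrBr mulr1 lerB // ler_pdivrMr ?ltr0n //.
  have qe : 0 <= q / e by rewrite divr_ge0 // ltW.
  rewrite -ler_pdivrMl // [e^-1 * q]mulrC (le_trans (ltW (archi_boundP qe))) //.
  by rewrite ler_nat -/m /n; lia.
apply: ereal_sup_ubound; exists (unbalanced_divisor w (n.-root w) m).
  exact: (unbalanced_divisor_indecomposable R m w _ c).
by rewrite (inner_unbalanced_divisor R m w _ c).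
Qed.
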